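(* Let $\mathbf{v}^*=(\mathbf{u}^*,\mathbf{x}^*,\mathbf{w}^* )$ be an S-stationary point of the optimal control problem (P) stated in the context, i.e. there exist MPCC multipliers $\mu_k\in\mathbb{R}^{n_x}$, $\nu_k\in\mathbb{R}^{n_w}$, $\lambda_k\in\mathbb{R}^{n_w}$ ($k=0,\dots,N-1$) satisfying the S-stationarity conditions given in the context. If additionally $\nu_k\ge0$ and $\lambda_k\ge0$ for all $k=0,\dots,N-1$, then $\mathbf{v}^*$ is a globally optimal solution of (P).
   Context: Notation: $\mathbb{N}_n=\{1,\dots,n\}$; superscripts in square brackets denote components of vectors or rows/entries of matrices; vector inequalities are componentwise; $a\perp b$ means $a^\top b=0$. LC model: state $x\in\mathbb{R}^{n_x}$, input $u\in\mathbb{R}^{n_u}$, complementarity variable $w\in\mathbb{R}^{n_w}$, $$x^+ = Ax+B_uu+B_ww+c,\qquad 0\le E_ww+E_xx+E_uu+e\ \perp\ w\ge 0,$$ with real matrices and vectors of compatible dimensions. Standing assumptions on the LC model. Well-posedness: for every fixed $(x,u)$, all $w$ solving the complementarity problem give the same $x^+$. Rank-one block structure: there exist $n_b\in\mathbb{N}$ and a partition of $\mathbb{N}_{n_w}$ into $n_b$ blocks of sizes $n_{w_1},\dots,n_{w_{n_b}}$ such that (after a corresponding simultaneous reordering of components of $w$ and rows) the complementarity problem decomposes into independent sub-problems $0\le M_iw_i+C_ix+D_iu+e_i\perp w_i\ge0$, $i\in\mathbb{N}_{n_b}$, with $M_i=m_im_i^\top$, $m_i\in\mathbb{R}^{n_{w_i}}$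 having no zero component. Nontrivial sub-problem solutions: for every $x,u$ and every $i\in\mathbb{N}_{n_b}$ there is $j\in\mathbb{N}_{n_{w_i}}$ with $C_i^{[j,:]}x+D_i^{[j,:]}u+e_i^{[j]}<0$. Optimal control problem (P): for a horizon $N\ge1$ and a given initial state $\bar x$, minimize over $\mathbf{u}=(u_0,\dots,u_{N-1})$, $\mathbf{x}=(x_0,\dots,x_N)$, $\mathbf{w}=(w_0,\dots,w_{N-1})$ $$J=\ell_N(x_N)+\sum_{k=0}^{N-1}\ell_k(x_k,u_k)$$ subject to $x_0=\bar x$ and, for $k=0,\dots,N-1$, $x_{k+1}=Ax_k+B_uu_k+B_ww_k+c$ and $0\le r_k\perp w_k\ge0$, where $r_k:=E_ww_k+E_xx_k+E_uu_k+e$. The costs $\ell_k,\ell_N$ are real-valued, convex and differentiable. S-stationarity: for feasible $\mathbf{v}^*$ let $r_k^*$ be the value of $r_k$ at $\mathbf{v}^*$ and, for each $k$, $\alpha_k=\{i: r_k^{*[i]}=0,\ w_k^{*[i]}>0\}$, $\beta_k=\{i: r_k^{*[i]}=0,\ w_k^{*[i]}=0\}$, $\gamma_k=\{i: r_k^{*[i]}>0,\ w_k^{*[i]}=0\}$. $\mathbf{v}^*$ is S-stationary if there exist $\mu_k,\nu_k,\lambda_k$, $k=0,\dots,N-1$, with $$\nabla\ell_N(x_N^* )+\mu_{N-1}=0,$$ $$\nabla_{x}\ell_k(x_k^*,u_k^* )+\mu_{k-1}-A^\top\mu_k-E_x^\top\nu_k=0\quad(k=1,\dots,N-1),$$ $$\nabla_{u}\ell_k(x_k^*,u_k^*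 )-B_u^\top\mu_k-E_u^\top\nu_k=0,\qquad -B_w^\top\mu_k-E_w^\top\nu_k-\lambda_k=0\quad(k=0,\dots,N-1),$$ and for every $k$: $\lambda_k^{[i]}=0$ for $i\in\alpha_k$; $\nu_k^{[i]}=0$ for $i\in\gamma_k$; $\nu_k^{[i]}\ge0$ and $\lambda_k^{[i]}\ge0$ for $i\in\beta_k$. *)

(* Defs.v *)
From HB Require Import structures.
From mathcomp Require Import all_boot all_order all_algebra.
From mathcomp Require Import boolp classical_sets reals topology normedtype.
From mathcomp Require Import derive convex.
Set Implicit Arguments.
Unset Strict Implicit.
Unset Printing Implicit Defensive.
Import Order.TTheory GRing.Theory Num.Theory.
Import numFieldNormedType.Exports.
Local Open Scope ring_scope.

Definition vnonneg (R : realType) (n : nat) (a : 'cV[R]_n) : Prop :=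
  forall i, 0 <= a i 0.

(* 0 <= a _|_ b >= 0 *)
Definition complementary (R : realType) (n : nat) (a b : 'cV[R]_n) : Prop :=
  [/\ vnonneg a, a^T *m b = 0 & vnonneg b].

Definition gradient (R : realType) (n : nat) (f : 'cV[R]_n -> R)
    (x : 'cV[R]_n) : 'cV[R]_n :=
  \col_(i < n) 'D_(delta_mx i 0) f x.

(* Convex and differentiable on the whole space; [convex_function] views E as
   a convex space and R as R^o. *)
Definition convex_differentiable (R : realType) (E : normedModType R)
    (f : E -> R) : Prop :=
  @convex_function R E setT f /\ forall x : E, differentiable f x.

Record lc_model (R : realType) (nx nu nw : nat) := LCModel {
  A : 'M[R]_nx;
  Bu : 'M[R]_(nx, nu);
  Bw : 'M[R]_(nx, nw);
  c : 'cV[R]_nx;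
  Ew : 'M[R]_nw;
  Ex : 'M[R]_(nw, nx);
  Eu : 'M[R]_(nw, nu);
  e : 'cV[R]_nw
}.

Definition lc_next (R : realType) (nx nu nw : nat) (L : lc_model R nx nu nw)
    (x : 'cV[R]_nx) (u : 'cV[R]_nu) (w : 'cV[R]_nw) : 'cV[R]_nx :=
  A L *m x + Bu L *m u + Bw L *m w + c L.

Definition lc_res (R : realType) (nx nu nw : nat) (L : lc_model R nx nu nw)
    (x : 'cV[R]_nx) (u : 'cV[R]_nu) (w : 'cV[R]_nw) : 'cV[R]_nw :=
  Ew L *m w + Ex L *m x + Eu L *m u + e L.

Definition lc_solution (R : realType) (nx nu nw : nat) (L : lc_model R nx nu nw)
    (x : 'cV[R]_nx) (u : 'cV[R]_nu) (w : 'cV[R]_nw) : Prop :=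
  complementary (lc_res L x u w) w.

Definition well_posed (R : realType) (nx nu nw : nat)
    (L : lc_model R nx nu nw) : Prop :=
  forall x u w w', lc_solution L x u w -> lc_solution L x u w' ->
    lc_next L x u w = lc_next L x u w'.

(* The bijection [blk_pos] lists the components of w block by block; reordering
   the rows of the complementarity problem and the components of w along it
   turns Ew into the block-diagonal matrix of the M_i = m_i m_i^T and stacks
   the C_i, D_i and e_i.  Here the block count may be 0 (only if nw = 0). *)
Record rank_one_blocks (R : realType) (nx nu nw : nat)
    (L : lc_model R nx nu nw) := RankOneBlocks {
  nb : nat;
  blk_size : 'I_nb -> nat;
  blk_size_gt0 : forall i, (0 < blk_size i)%N;
  blk_pos : 'I_(\sum_(i < nb) blk_size i) -> 'I_nw;
  blk_pos_bij : bijective blk_pos;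
  blk_m : forall i : 'I_nb, 'cV[R]_(blk_size i);
  blk_C : forall i : 'I_nb, 'M[R]_(blk_size i, nx);
  blk_D : forall i : 'I_nb, 'M[R]_(blk_size i, nu);
  blk_e : forall i : 'I_nb, 'cV[R]_(blk_size i);
  blk_m_neq0 : forall (i : 'I_nb) (j : 'I_(blk_size i)), blk_m i j 0 != 0;
  blk_EwE : mxsub blk_pos blk_pos (Ew L)
            = \mxdiag_(i < nb) (blk_m i *m (blk_m i)^T);
  blk_ExE : rowsub blk_pos (Ex L) = \mxcol_(i < nb) blk_C i;
  blk_EuE : rowsub blk_pos (Eu L) = \mxcol_(i < nb) blk_D i;
  blk_eE : rowsub blk_pos (e L) = \mxcol_(i < nb) blk_e i
}.

Definition nontrivial_blocks (R : realType) (nx nu nw : nat)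
    (L : lc_model R nx nu nw) (B : rank_one_blocks L) : Prop :=
  forall (x : 'cV[R]_nx) (u : 'cV[R]_nu) (i : 'I_(nb B)),
    exists j : 'I_(blk_size i),
      (blk_C i *m x + blk_D i *m u + blk_e i) j 0 < 0.

(* The optimal control problem of horizon N; the stage costs are jointly
   functions of the pair (x, u). *)
Record ocp (R : realType) (nx nu nw N : nat) := OCP {
  lc : lc_model R nx nu nw;
  x_init : 'cV[R]_nx;
  stage_cost : 'I_N -> 'cV[R]_nx * 'cV[R]_nu -> R;
  final_cost : 'cV[R]_nx -> R
}.

Record trajectory (R : realType) (nx nu nw N : nat) := Trajectory {
  inp : 'I_N -> 'cV[R]_nu;
  state : 'I_N.+1 -> 'cV[R]_nx;
  compl : 'I_N -> 'cV[R]_nw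
}.

Section OptimalControl.
Variables (R : realType) (nx nu nw N : nat).
Implicit Types (P : ocp R nx nu nw N) (v : trajectory R nx nu nw N).

(* x_k and x_{k+1} for k < N *)
Definition cur_state v (k : 'I_N) : 'cV[R]_nx :=
  state v (widen_ord (leqnSn N) k).
Definition next_state v (k : 'I_N) : 'cV[R]_nx := state v (lift ord0 k).

Definition residual P v (k : 'I_N) : 'cV[R]_nw :=
  lc_res (lc P) (cur_state v k) (inp v k) (compl v k).

Definition cost P v : R :=
  final_cost P (state v ord_max)
  + \sum_(k < N) stage_cost P k (cur_state v k, inp v k).

Definition feasible P v : Prop :=
  state v ord0 = x_init P /\
  forall k : 'I_N,
    next_state v k = lc_next (lc P) (cur_state v k) (inp v k) (compl v k) /\
    complementary (residual P v k) (compl v k).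

Definition globally_optimal P v : Prop :=
  feasible P v /\ forall v', feasible P v' -> cost P v <= cost P v'.

Definition alpha P v (k : 'I_N) : {pred 'I_nw} :=
  [pred i | (residual P v k i 0 == 0) && (0 < compl v k i 0)].
Definition beta P v (k : 'I_N) : {pred 'I_nw} :=
  [pred i | (residual P v k i 0 == 0) && (compl v k i 0 == 0)].
Definition gamma P v (k : 'I_N) : {pred 'I_nw} :=
  [pred i | (0 < residual P v k i 0) && (compl v k i 0 == 0)].

Definition grad_x P v (k : 'I_N) : 'cV[R]_nx :=
  gradient (fun x => stage_cost P k (x, inp v k)) (cur_state v k).
Definition grad_u P v (k : 'I_N) : 'cV[R]_nu :=
  gradient (fun u => stage_cost P k (cur_state v k, u)) (inp v k).

(* v is S-stationary with multipliers mu, nu, lam.  In [s_final], k = N - 1; in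
   [s_state], (j, k) ranges over the pairs (k - 1, k) with 1 <= k <= N - 1. *)
Record S_stationary P v (mu : 'I_N -> 'cV[R]_nx) (nu_ lam : 'I_N -> 'cV[R]_nw)
    : Prop := SStationary {
  s_feasible : feasible P v;
  s_final : forall k : 'I_N, k.+1 = N ->
    gradient (final_cost P) (state v ord_max) + mu k = 0;
  s_state : forall j k : 'I_N, k = j.+1 :> nat ->
    grad_x P v k + mu j - (A (lc P))^T *m mu k - (Ex (lc P))^T *m nu_ k = 0;
  s_input : forall k : 'I_N,
    grad_u P v k - (Bu (lc P))^T *m mu k - (Eu (lc P))^T *m nu_ k = 0;
  s_compl : forall k : 'I_N,
    - ((Bw (lc P))^T *m mu k) - (Ew (lc P))^T *m nu_ k - lam k = 0;
  s_alpha : forall (k : 'I_N) i, i \in alpha P v k -> lam k i 0 = 0;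
  s_gamma : forall (k : 'I_N) i, i \in gamma P v k -> nu_ k i 0 = 0;
  s_beta : forall (k : 'I_N) i, i \in beta P v k ->
    0 <= nu_ k i 0 /\ 0 <= lam k i 0
}.

End OptimalControl.

(* Main.v *)
(* For fixed multipliers with [nu_, lam >= 0], stationarity and the tangent
   inequality for the convex costs bound [cost v' - cost v] below by
   [sum_k nu_k . (r'_k - r_k) + lam_k . (w'_k - w_k)]: the terms in [mu]
   telescope along the dynamics, whose initial state is fixed. The stationarity
   conditions on the index sets make [nu_k . r_k] and [lam_k . w_k] vanish, so
   only [nu_k . r'_k + lam_k . w'_k >= 0] remains. Thus v is optimal even for
   the convex relaxation without the complementarity condition. *)
Require Import Defs.
From mathcomp Require Import all_boot all_order all_algebra.
From mathcomp Require Import reals normedtype.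
From mathcomp Require Import boolp classical_sets unstable.
From mathcomp Require Import interval_inference topology.
From mathcomp Require Import derive convex lra ring.
Import Order.TTheory GRing.Theory Num.Theory.
Import numFieldNormedType.Exports.
Local Open Scope ring_scope.

Section ConvexTangent.
Context {R : realType}.

(** Convexity bounds the difference quotient along [b - a] by [f b - f a] at every step
    [0 < h <= 1]; the derivative is its limit as [h] tends to 0 from the right. *)
Lemma convex_derive_le (E : normedModType R) (f : E -> R) (a b : E) :
  convex_differentiable f -> 'D_(b - a) f a <= f b - f a.
Proof.
move=> [f_convex f_diff].
have f_derivable : derivable f a (b - a) by exact: diff_derivable.
rewrite /derive derive.cvg_at_rightE //; apply: limr_le.
  (* The one-sided limit exists because right neighbourhoods of 0 refine the punctured ones. *)
  apply: cvgP; apply: cvg_trans f_derivable; apply: cvg_app.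
  move=> S /nbhs_ballP[e /= e_gt0 e_S]; exists e => //= h h_e h_gt0.
  by apply: e_S => //; rewrite gt_eqF.
near=> h.
have h_gt0 : 0 < h by near: h; exact: nbhs_right_gt.
have h_le1 : h <= 1 by near: h; exact: nbhs_right_ltW.
have := f_convex (Itv01 (ltW h_gt0) h_le1) b a (in_setT _) (in_setT _).
rewrite /conv /= /conv /=.
have -> : h *: b + onem h *: a = h *: (b - a) + a.
  by rewrite /onem scalerBr scalerBl scale1r addrAC addrA.
move=> f_le; rewrite /= /GRing.scale /= ler_pdivrMl // lerBlDr (le_trans f_le) //.
by rewrite /GRing.scale /= /onem; lra.
Unshelve. all: by end_near. Qed.

Lemma gradient_derive (n : nat) (f : 'cV[R]_n -> R) (x d : 'cV[R]_n) :
  differentiable f x -> 'D_d f x = ((gradient f x)^T *m d) 0 0.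
Proof.
move=> f_diff; rewrite deriveE // [in LHS](matrix_sum_delta d) linear_sum mxE.
apply: eq_bigr => i _; rewrite big_ord1 linearZ !mxE deriveE //.
by rewrite mulrC.
Qed.

Lemma differentiable_pairl (V W : normedModType R) (f : V * W -> R) x u :
  differentiable f (x, u) -> differentiable (fun y => f (y, u)) x.
Proof.
move=> f_diff.
have -> : (fun y => f (y, u)) = f \o (fun y => (y, u)) by [].
by apply: differentiable_comp => //; apply: differentiable_pair.
Qed.

Lemma differentiable_pairr (V W : normedModType R) (f : V * W -> R) x u :
  differentiable f (x, u) -> differentiable (fun y => f (x, y)) u.
Proof.
move=> f_diff.
have -> : (fun y => f (x, y)) = f \o (fun y => (x, y)) by [].
by apply: differentiable_comp => //; apply: differentiable_pair.
Qed.

(** The differential is linear and [(d, e) = (d, 0) + (0, e)]; moving along either summand keeps the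
    other coordinate fixed. *)
Lemma derive_pair (V W : normedModType R) (f : V * W -> R) x u d e :
  differentiable f (x, u) ->
  'D_(d, e) f (x, u) = 'D_d (fun y => f (y, u)) x + 'D_e (fun y => f (x, y)) u.
Proof.
move=> f_diff.
have -> : 'D_d (fun y => f (y, u)) x = 'D_(d, 0) f (x, u).
  rewrite /derive; do 2 f_equal; apply/funext => h.
  rewrite /= (_ : h *: (d, 0) + (x, u) = (h *: d + x, h *: 0 + u)) //.
  by rewrite scaler0 add0r.
have -> : 'D_e (fun y => f (x, y)) u = 'D_(0, e) f (x, u).
  rewrite /derive; do 2 f_equal; apply/funext => h.
  rewrite /= (_ : h *: (0, e) + (x, u) = (h *: 0 + x, h *: e + u)) //.
  by rewrite scaler0 add0r.
rewrite !deriveE // -linearD (_ : (d, 0) + (0, e) = (d + 0, 0 + e)) //.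
by rewrite addr0 add0r.
Qed.

End ConvexTangent.

Section SStationaryBound.
Context {R : realType} {nx nu nw N : nat}.
Implicit Types (P : ocp R nx nu nw N) (v : trajectory R nx nu nw N).

Lemma vnonneg_dot (n : nat) (a b : 'cV[R]_n) :
  vnonneg a -> vnonneg b -> 0 <= (a^T *m b) 0 0.
Proof.
by move=> a_ge0 b_ge0; rewrite mxE sumr_ge0 // => i _; rewrite mxE mulr_ge0.
Qed.

Lemma complementary_eq0 (n : nat) (a b : 'cV[R]_n) i :
  complementary a b -> a i 0 = 0 \/ b i 0 = 0.
Proof.
move=> [a_ge0 /matrixP/(_ 0 0) + b_ge0]; rewrite !mxE => ab0.
have ab_ge0 j : true -> 0 <= a^T 0 j * b j 0 by rewrite mxE mulr_ge0.
have /eqP := psumr_eq0P ab_ge0 ab0 (erefl : (fun=> true) i).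
by rewrite mxE mulf_eq0 => /orP[] /eqP; [left|right].
Qed.

Lemma stage_cost_lower_bound (f : 'cV[R]_nx * 'cV[R]_nu -> R) x u x' u' :
  convex_differentiable f ->
  ((gradient (fun y => f (y, u)) x)^T *m (x' - x)
   + (gradient (fun y => f (x, y)) u)^T *m (u' - u)) 0 0
  <= f (x', u') - f (x, u).
Proof.
move=> f_cd; apply: le_trans (convex_derive_le _ _ (x, u) (x', u') f_cd).
have f_diff := f_cd.2 (x, u).
rewrite [leRHS](derive_pair _ _ _ _ _ (x' - x) (u' - u)) // mxE.
rewrite !gradient_derive //; first exact: differentiable_pairr.
exact: differentiable_pairl.
Qed.

(* The condition on [gx] is only required against [x' - x]: at k = 0 there is no
   stationarity in the state, but there [x' = x]. *)
Lemma stationary_stage (L : lc_model R nx nu nw) (gx p mu : 'cV[R]_nx)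
    (gu : 'cV[R]_nu) (eta lam : 'cV[R]_nw) x u w x' u' w' :
  (gx + p - (A L)^T *m mu - (Ex L)^T *m eta)^T *m (x' - x) = 0 ->
  gu - (Bu L)^T *m mu - (Eu L)^T *m eta = 0 ->
  - ((Bw L)^T *m mu) - (Ew L)^T *m eta - lam = 0 ->
  gx^T *m (x' - x) + gu^T *m (u' - u)
  = mu^T *m (lc_next L x' u' w' - lc_next L x u w) - p^T *m (x' - x)
    + eta^T *m (lc_res L x' u' w' - lc_res L x u w) + lam^T *m (w' - w).
Proof.
move=> gx_eq gu_eq /eqP; rewrite subr_eq0 => /eqP <-.
have -> : gu = (Bu L)^T *m mu + (Eu L)^T *m eta.
  by apply/eqP; rewrite -subr_eq0 opprD addrA gu_eq.
(* The constant terms cancel, so both differences are linear in the increments of [x], [u] and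
   [w]. *)
have -> : lc_next L x' u' w' - lc_next L x u w
    = A L *m (x' - x) + Bu L *m (u' - u) + Bw L *m (w' - w).
  rewrite !mulmxBr /lc_next opprD addrACA subrr addr0.
  by rewrite !opprD addrACA [X in X + _]addrACA.
have -> : lc_res L x' u' w' - lc_res L x u w
    = Ew L *m (w' - w) + Ex L *m (x' - x) + Eu L *m (u' - u).
  rewrite !mulmxBr /lc_res opprD addrACA subrr addr0.
  by rewrite !opprD addrACA [X in X + _]addrACA.
move: (x' - x) (u' - u) (w' - w) gx_eq => dx du dw.
rewrite !(linearB, linearD, linearN) /= !(trmx_mul, trmxK).
rewrite !(mulmxBl, mulmxDl, mulNmx, mulmxDr, mulmxA) => gx_eq.
(* With [gu] and [lam] eliminated, the two sides differ exactly by the expanded left-hand side of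
   [gx_eq]. *)
apply/eqP; rewrite -subr_eq0 -[X in _ == X]gx_eq; apply/eqP/matrixP=> i j.
by rewrite !mxE; ring.
Qed.

(** Each product vanishes componentwise: a nonzero residual entry puts the index in [gamma], where
    [nu_] is 0, and a nonzero entry of [compl] puts it in [alpha], where [lam] is 0. *)
Lemma S_stationary_orthogonal P v mu nu_ lam k :
  S_stationary P v mu nu_ lam ->
  (nu_ k)^T *m residual P v k = 0 /\ (lam k)^T *m compl v k = 0.
Proof.
move=> S; have [_ /(_ k) [_ rw]] := s_feasible S; have [r_ge0 _ w_ge0] := rw.
split; apply/matrixP => a b; rewrite !ord1 !mxE big1 // => i _; rewrite mxE.
- have [-> | r_neq0] := eqVneq (residual P v k i 0) 0; first by rewrite mulr0.
  rewrite (s_gamma S) ?mul0r // inE lt_neqAle eq_sym r_neq0 r_ge0 /=.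
  by case: (complementary_eq0 _ _ _ i rw) => [/eqP|->]; rewrite ?(negPf r_neq0).
- have [-> | w_neq0] := eqVneq (compl v k i 0) 0; first by rewrite mulr0.
  rewrite (s_alpha S) ?mul0r // inE lt_neqAle [0 == _]eq_sym w_neq0 w_ge0.
  by case: (complementary_eq0 _ _ _ i rw) => [->|/eqP];
    rewrite ?eqxx ?(negPf w_neq0).
Qed.

End SStationaryBound.

Theorem theorem2 (R : realType) (nx nu nw N : nat)
    (P : ocp R nx nu nw N) (B : rank_one_blocks (lc P))
    (v : trajectory R nx nu nw N)
    (mu : 'I_N -> 'cV[R]_nx) (nu_ lam : 'I_N -> 'cV[R]_nw) :
  (1 <= N)%N ->
  well_posed (lc P) ->
  nontrivial_blocks B ->
  (forall k : 'I_N, convex_differentiable (stage_cost P k)) ->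
  convex_differentiable (final_cost P) ->
  S_stationary P v mu nu_ lam ->
  (forall k : 'I_N, vnonneg (nu_ k) /\ vnonneg (lam k)) ->
  globally_optimal P v.
Proof.
move=> N_gt0 _ _ stage_cd final_cd S multipliers_ge0.
split=> [|v' [v'0 v'_step]]; first exact: s_feasible S.
have [v0 v_step] := s_feasible S.
(* [p] is the costate shifted to match the states: [p j] is [mu] at [j - 1], with the default 0 at
   [j = 0]. The quantity [q] built from it is what telescopes. *)
pose p (j : 'I_N.+1) := if unlift ord0 j is Some i then mu i else 0.
pose q j : R := ((p j)^T *m (state v' j - state v j)) 0 0.
have q0 : q ord0 = 0 by rewrite /q v0 v'0 subrr mulmx0 mxE.
have stage_le k : q (lift ord0 k) - q (widen_ord (leqnSn N) k)
    <= stage_cost P k (cur_state v' k, inp v' k)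
       - stage_cost P k (cur_state v k, inp v k).
  have [v_next _] := v_step k; have [v'_next [r'_ge0 _ w'_ge0]] := v'_step k.
  have [nu_ge0 lam_ge0] := multipliers_ge0 k.
  have [nu_r lam_w] := S_stationary_orthogonal _ _ _ _ _ k S.
  apply: le_trans (stage_cost_lower_bound _ _ _ _ _ (stage_cd k)).
  have gx_eq : (grad_x P v k + p (widen_ord (leqnSn N) k)
      - (A (lc P))^T *m mu k - (Ex (lc P))^T *m nu_ k)^T
      *m (cur_state v' k - cur_state v k) = 0.
    rewrite /p; case: unliftP => [j /(congr1 val) /= jk | k0].
      by rewrite (s_state S) ?trmx0 ?mul0mx.
    by rewrite /cur_state k0 v0 v'0 subrr mulmx0.
  rewrite (stationary_stage (lc P) _ (p (widen_ord (leqnSn N) k)) (mu k) _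
    (nu_ k) (lam k) _ _ (compl v k) _ _ (compl v' k) gx_eq (s_input S k)
    (s_compl S k)).
  rewrite -v_next -v'_next -/(residual P v k) -/(residual P v' k).
  rewrite !(mulmxBr _^T (residual _ _ _)) !(mulmxBr _^T (compl _ _)).
  rewrite nu_r lam_w !subr0 /q {1}/p liftK -/(next_state v k).
  rewrite -/(next_state v' k) -/(cur_state v k) -/(cur_state v' k).
  rewrite [leRHS]mxE [X in _ <= X + _]mxE.
  (* What exceeds the increment of [q] is the sum of the products of [nu_] with the new residual and
     of [lam] with the new [compl]. *)
  have := vnonneg_dot _ _ _ nu_ge0 r'_ge0.
  have := vnonneg_dot _ _ _ lam_ge0 w'_ge0.
  rewrite [X in _ <= X + _ + _]mxE [X in _ <= _ + X + _ + _]mxE.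
  by move=> lam_w' nu_r'; rewrite -addrA lerDl addr_ge0.
have final_le : - q ord_max
    <= final_cost P (state v' ord_max) - final_cost P (state v ord_max).
  have [n Nn] : {n | N = n.+1} by case: (N) N_gt0 => // n; exists n.
  have k_ltN : (n < N)%N by rewrite Nn.
  have max_lift : ord_max = lift ord0 (Ordinal k_ltN).
    by apply: val_inj; rewrite /= /bump /= add1n Nn.
  apply: le_trans (convex_derive_le _ _ _ _ final_cd).
  rewrite gradient_derive; last by case: final_cd.
  (* Final stationarity makes the gradient [- mu] at index [N - 1], which is [- p ord_max]. *)
  have /eqP := s_final S (k := Ordinal k_ltN) (esym Nn).
  rewrite addr_eq0 => /eqP ->.
  by rewrite linearN mulNmx mxE /q /p max_lift liftK.
rewrite -subr_ge0 /cost opprD addrACA -sumrB.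
apply: le_trans (lerD final_le (ler_sum _ (fun k _ => stage_le k))).
(* Adding and subtracting [q ord0] completes the shifted sum to one over all [N + 1] states;
   splitting off its last term instead cancels everything but [- q ord0 = 0]. *)
rewrite sumrB -[X in _ <= _ + (X - _)](addKr (q ord0)).
by rewrite -big_ord_recl /= big_ord_recr /= q0; lra.
Qed.
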